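(* Let $V_P=V_Q\oplus V_{Q+\alpha/2}$ be the lattice construction of the two level $1$ standard $A_1^{(1)}$-modules $L(\Lambda_0)=V_Q$ and $L(\Lambda_1)=V_{Q+\alpha/2}$, with principal subspaces $W(\Lambda_0)\subset V_Q$ and $W(\Lambda_1)\subset V_{Q+\alpha/2}$. Let $\mathcal{Y}(\cdot,x)$ be the intertwining operator of type $\binom{L(\Lambda_1)}{L(\Lambda_1)\ L(\Lambda_0)}$ given by $\mathcal{Y}(w,x)=Y(w,x)e^{i\pi\alpha/2}$ (for $w \in V_{Q+\alpha/2}$, acting on $V_Q$), and let $$o(e^{\alpha/2})=\mathrm{Res}_x\, x^{-1}\mathcal{Y}(e^{\alpha/2},x): V_Q\to V_{Q+\alpha/2}$$ be the constant term (coefficient of $x^0$) of $\mathcal{Y}(e^{\alpha/2},x)$. Let $e^{\alpha/2}:V_P\to V_P$ denote the operator $1\otimes e^{\alpha/2}$. Then $e^{\alpha/2}$ maps $W(\Lambda_1)$ into $W(\Lambda_0)$, $o(e^{\alpha/2})$ maps $W(\Lambda_0)$ into $W(\Lambda_1)$, and the sequence $$0\longrightarrow W(\Lambda_1)\stackrel{e^{\alpha/2}}{\longrightarrow}W(\Lambda_0)\stackrel{o(e^{\alpha/2})}{\longrightarrow}W(\Lambda_1)\longrightarrow 0$$ is exact.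
   Context: Let $\mathfrak{g}=\mathfrak{sl}(2,\mathbb{C})$ with Cartan subalgebra $\mathfrak{h}=\mathbb{C}h$, form $\langle x,y\rangle=\mathrm{tr}(xy)$, and positive root $\alpha$; via the form, $\mathfrak{h}^*$ is identified with $\mathfrak{h}$, so that $\alpha=h$ and $\langle\alpha,\alpha\rangle=2$. Let $Q=\mathbb{Z}\alpha$ and $P=\frac12\mathbb{Z}\alpha$, with group algebras $\mathbb{C}[Q]\subset\mathbb{C}[P]$ having bases $\{e^\mu\}$ (so $e^\lambda e^\mu=e^{\lambda+\mu}$). Fock space: $M(1)=\mathbb{C}[h(-1),h(-2),\dots]$ is the polynomial algebra on which $h(-n)$ ($n>0$) acts by multiplication and $h(n)$ ($n>0$) acts as the derivation $2n\,\partial/\partial h(-n)$; thus $[h(m),h(n)]=2m\,\delta_{m+n,0}$. Put $V_P=M(1)\otimes\mathbb{C}[P]$, $V_Q=M(1)\otimes\mathbb{C}[Q]$, $V_{Q+\alpha/2}=M(1)\otimes e^{\alpha/2}\mathbb{C}[Q]$. The operators $h(n)$, $n\neq0$, act on the first factor, and $h(0)$ acts on the second factor by $h(0)e^\lambda=\langle h,\lambda\rangle e^\lambda$. For $\lambda=c\,\alpha$ write $\lambda(n)=c\,h(n)$. On $V_P$, $e^\lambda$ also denotes the operator $1\otimes(\text{multiplication by }e^\lambda)$, and $x^\lambda$ denotes the operator $1\otimes x^\lambda$ with $x^\lambda\cdot e^\mu=x^{\langle\lambda,\mu\rangle}e^\mu$. A vector $1\otimes e^\lambda$ is written $e^\lambda$.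 Vertex operators: for $\lambda\in P$, $$Y(e^\lambda,x)=E^-(-\lambda,x)E^+(-\lambda,x)e^\lambda x^\lambda,$$ $$E^-(\lambda,x)=\exp\Big(\sum_{n\le-1}\frac{\lambda(n)}{n}x^{-n}\Big),\qquad E^+(\lambda,x)=\exp\Big(\sum_{n\ge1}\frac{\lambda(n)}{n}x^{-n}\Big).$$ (For a general vector $w=h(-n_1-1)\cdots h(-n_k-1)\otimes e^\lambda$, $Y(w,x)$ is the normally ordered product of the series $\frac{1}{n_i!}(d/dx)^{n_i}h(x)$ with $Y(e^\lambda,x)$, where $h(x)=\sum_{n\in\mathbb{Z}}h(n)x^{-n-1}$; only $w=e^{\alpha/2}$ is needed for the statement.) The operator $e^{i\pi\alpha/2}$ means $e^{i\pi\alpha(0)/2}$, i.e. it acts on $M(1)\otimes e^{\mu}$ as the scalar $e^{i\pi\langle\alpha,\mu\rangle/2}$; on $M(1)\otimes e^{n\alpha}\subset V_Q$ it is $(-1)^n$. On $V_Q$, $\mathcal{Y}(e^{\alpha/2},x)$ involves only integral powers of $x$, and $\mathcal{Y}(e^{\alpha/2},x)v\in V_{Q+\alpha/2}((x))$ for $v\in V_Q$. $\mathrm{Res}_x$ denotes the coefficient of $x^{-1}$. For $m\in\mathbb{Z}$ let $x_\alpha(m)$ be the coefficient of $x^{-m-1}$ in $Y(e^\alpha,x)$, an operator on $V_P$. (With $x_{\pm\alpha}(m)$ the coefficient of $x^{-m-1}$ in $Y(e^{\pm\alpha},x)$, $V_P$ becomes a level $1$ module for the affine Lie algebra $\widehat{\mathfrak{sl}(2)}$,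 and $V_Q$, $V_{Q+\alpha/2}$ are the irreducible highest weight modules $L(\Lambda_0)$, $L(\Lambda_1)$ with highest weight vectors $v_{\Lambda_0}=1=1\otimes1$ and $v_{\Lambda_1}=e^{\alpha/2}$.) The operators $x_\alpha(m)$, $m\in\mathbb{Z}$, commute with one another. Principal subspaces: $W(\Lambda_j)=U(\mathfrak{n}_+\otimes\mathbb{C}[t,t^{-1}])v_{\Lambda_j}$, $j=0,1$, where $\mathfrak{n}_+=\mathbb{C}x_\alpha$; i.e. $W(\Lambda_j)$ is the linear span of all vectors $x_\alpha(m_1)\cdots x_\alpha(m_k)v_{\Lambda_j}$ with $k\ge0$, $m_1,\dots,m_k\in\mathbb{Z}$. *)

(* Defs.v *)
From HB Require Import structures.
From mathcomp Require Import all_boot all_order all_algebra finmap.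
From mathcomp Require Import all_classical all_reals all_analysis.
From mathcomp Require Import complex.
(* The notations of monalg clash with those of the analysis library. *)
From mathcomp.multinomials Require Import -(notations) monalg.
From mathcomp.multinomials Require Import freeg.

Set Implicit Arguments.
Unset Strict Implicit.
Unset Printing Implicit Defensive.

Import Order.TTheory GRing.Theory Num.Theory.

Local Open Scope ring_scope.

(* The integer n stands for the element n alpha/2 of P = (1/2) Z alpha. *)
Notation weight := int.

Definition alpha : weight := 2.
Definition half_alpha : weight := 1.

(* <l alpha/2, m alpha/2> = l m / 2, since <alpha, alpha> = 2. *)
Definition pairing (l m : weight) : rat := (l * m)%:~R / 2%:R.

(* The monomials in h(-1), h(-2), ...; the variable h(-n) has index n.-1. *)
Notation monomial := (cmonom nat).

Section FockSpace.
Variable C : fieldType.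
Implicit Types (l : weight) (q : rat) (b : monomial * weight).

(* M(1) (x) C[P]: the basis vector << (f, mu) >> is f (x) e^mu. *)
Definition VP : Type := {freeg (monomial * weight) / C}.

HB.instance Definition _ := GRing.Lmodule.on VP.

Implicit Types v : VP.

Definition exp_vec l : VP := << (onecm nat, l) >>.

(* h(n); for n > 0 it acts on M(1) as 2 n d/dh(-n). *)
Definition heis (n : int) : VP -> VP :=
  fglift (fun b => match n return VP with
    | Posz 0 => << (ratr (pairing alpha b.2) : C) *g b >>
    | Posz i.+1 =>
        << (2 * i.+1 * b.1 i)%:R *g (divcm b.1 (ucm i), b.2) >>
    | Negz i => << (mulcm b.1 (ucm i), b.2) >>
    end).

(* lambda(n) = c h(n) for lambda = c alpha; here c = l / 2. *)
Definition lattice_mode l (n : int) v : VP := (l%:~R / 2%:R : C) *: heis n v.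

(* The operator e^lambda = 1 (x) (multiplication by e^lambda). *)
Definition exp_op l : VP -> VP :=
  fglift (fun b => << (b.1, l + b.2) >> : VP).

(* The coefficient of x^q in x^lambda: the projection onto the sum of the     *)
(* M(1) (x) e^mu with <lambda, mu> = q.  The exponents lie in (1/2)Z.         *)
Definition xpow_op l q : VP -> VP :=
  fglift (fun b => if pairing l b.2 == q then << b >> else 0 : VP).

(* A sequence A of operators represents the formal series sum_k A_k z^k;      *)
(* series_pow A r k is the coefficient of z^k in its r-th power.              *)
Fixpoint series_pow (A : nat -> VP -> VP) (r k : nat) v : VP :=
  if r is s.+1 then \sum_(j < k.+1) A j (series_pow A s (k - j) v)
  else if k == 0%N then v else 0.

(* The coefficient of z^k in exp(sum_j A_j z^j), for a series with A_0 = 0:   *)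
(* the r-th power then contributes only when r <= k.                          *)
Definition series_exp (A : nat -> VP -> VP) (k : nat) v : VP :=
  \sum_(r < k.+1) (r`!%:R^-1 : C) *: series_pow A r k v.

(* The coefficient of x^k in E^-(lambda, x), whose exponent is the sum over   *)
(* n >= 1 of lambda(-n) / (-n) x^n.                                           *)
Definition Eminus l : nat -> VP -> VP :=
  series_exp (fun n v => if n == 0%N then 0
                         else ((- n%:R)^-1 : C) *: lattice_mode l (- n%:Z) v).

(* The coefficient of x^(-k) in E^+(lambda, x). *)
Definition Eplus l : nat -> VP -> VP :=
  series_exp (fun n v => if n == 0%N then 0
                         else (n%:R^-1 : C) *: lattice_mode l n%:Z v).

(* The coefficient of x^q in Y(e^lambda, x) v: the sum over j, k >= 0 of      *)
(* E^-_j E^+_k e^lambda (x^lambda)_(q - j + k) v, the powers of x being x^j,  *)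
(* x^(-k) and x^(q - j + k).  For a fixed v only finitely many terms are      *)
(* nonzero, because the operator E^+_k kills v for k large.                   *)
Definition vertex_coef l q v : VP :=
  \sum_(jk \in [set: nat * nat])
    Eminus (- l) jk.1
      (Eplus (- l) jk.2 (exp_op l (xpow_op l (q - jk.1%:R + jk.2%:R) v))).

Definition x_alpha (m : int) : VP -> VP := vertex_coef alpha (- m - 1)%:~R.

(* The span of the vectors x_alpha(m_1) ... x_alpha(m_k) v, k >= 0. *)
Definition principal_subspace v : set VP :=
  [set w | exists s : seq (C * seq int),
     w = \sum_(t <- s) t.1 *: foldr x_alpha v t.2]%classic.

Definition W_Lambda0 : set VP := principal_subspace (exp_vec 0).
Definition W_Lambda1 : set VP := principal_subspace (exp_vec half_alpha).

End FockSpace.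

Section Intertwiner.
Variable R : realType.
Implicit Types (l : weight) (q : rat).

(* e^(i theta) *)
Definition expi (theta : R) : R[i] := (cos theta +i* sin theta)%C.

(* The operator e^(i pi alpha(0) / 2). *)
Definition exp_ipi_half_alpha : VP R[i] -> VP R[i] :=
  fglift (fun b : monomial * weight =>
    << expi (pi * ratr (pairing alpha b.2) / 2%:R) *g b >> : VP R[i]).

(* The coefficient of x^q in Y(e^lambda, x) e^(i pi alpha / 2) v. *)
Definition intertwiner_coef l q (v : VP R[i]) : VP R[i] :=
  vertex_coef l q (exp_ipi_half_alpha v).

(* This is defined on V_P, but is the operator of interest on V_Q only. *)
Definition o_half_alpha : VP R[i] -> VP R[i] := intertwiner_coef half_alpha 0.

End Intertwiner.

(* f maps A into B, g maps B into D, and 0 -> A -> B -> D -> 0 is exact. *)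
Definition short_exact (K : pzRingType) (U V W : lmodType K)
    (A : set U) (B : set V) (D : set W) (f : U -> V) (g : V -> W) : Prop :=
  [/\ (f @` A `<=` B)%classic, (g @` B `<=` D)%classic,
      {in A &, injective f},
      ([set v | B v /\ g v = 0] = f @` A)%classic &
      (g @` B = D)%classic].

(* Main.v *)
From HB Require Import structures.
Require Import Defs.
From mathcomp Require Import all_boot all_order all_algebra.
From mathcomp Require Import all_classical all_reals all_analysis.
From mathcomp Require Import complex.
From mathcomp Require Import finmap zify ring lra.
From mathcomp.multinomials Require Import -(notations) monalg.
From mathcomp.multinomials Require Import freeg.

(* Identify h(-m)/m with the m-th power sum p_m(y)/m; then the coefficients S_r
   of exp (sum_m h(-m) z^m / m) are the complete symmetric functions, and the
   products S_r1 ... S_rk (with S_0 = 1 allowed) span the part F_k of M(1)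
   generated by the Schur functions with at most k rows.

   Both principal subspaces are described by F_k: W(Lambda_0) is the sum of the
   F_k (x) e^(k alpha), and W(Lambda_1) that of the F_k (x) e^(k alpha + alpha/2).
   Indeed, on such vectors x_alpha(m) is a sum of terms E^-_j E^+_i e^alpha,
   where E^-_j is multiplication by S_j and E^+_i preserves F_k and lowers the
   degree by i; so modulo lower degree x_alpha(m) adds one arbitrary factor S_j.

   Commuting E^+(-alpha/2, x) past the generating series of S_r contributes the
   factor 1 - z/x.  Hence Y(e^(alpha/2), x) acts on the generating function of
   the products of k factors through the product of the x - z_i, and its
   constant term o(e^(alpha/2)) sends S_r1 ... S_rk to S_(r1 - 1) ... S_(rk - 1),
   or to 0 if some r_i = 0.  As the S_r with r > 0 are algebraically independent,
   the kernel on F_k is spanned by the products containing S_0, that is, by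
   F_(k-1), which is the image of e^(alpha/2). *)

Set Implicit Arguments.
Unset Strict Implicit.
Unset Printing Implicit Defensive.

Import Order.TTheory GRing.Theory Num.Theory.

Local Open Scope ring_scope.

(** * Linear spans and linear operators on Fock space *)

Section Span.
Variable K : pzRingType.

(** Adding one multiple at a time allows linear statements to be proved by induction; [spanP] gives
    the equivalent form by finite lists. *)
Inductive span (V : lmodType K) (G : V -> Prop) : V -> Prop :=
| span0 : span G 0
| span_step a g v : G g -> span G v -> span G (a *: g + v).

Lemma span_gen (V : lmodType K) (G : V -> Prop) g : G g -> span G g.
Proof. by move=> Gg; rewrite -[g]scale1r -[_ *: g]addr0; apply/span_step/span0. Qed.

Lemma spanD (V : lmodType K) (G : V -> Prop) u v :
  span G u -> span G v -> span G (u + v).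
Proof.
elim=> [|a g w Gg _ IH] Gv; first by rewrite add0r.
by rewrite -addrA; apply: span_step => //; apply: IH.
Qed.

Lemma spanZ (V : lmodType K) (G : V -> Prop) a v : span G v -> span G (a *: v).
Proof.
elim=> [|b g w Gg _ IH]; first by rewrite scaler0; apply: span0.
by rewrite scalerDr scalerA; apply: span_step.
Qed.

Lemma spanB (V : lmodType K) (G : V -> Prop) u v :
  span G u -> span G v -> span G (u - v).
Proof. by move=> Gu Gv; rewrite -scaleN1r; apply/spanD/spanZ. Qed.

Lemma span_sum (V : lmodType K) (G : V -> Prop) I (r : seq I) (P : pred I) F :
  (forall i, P i -> span G (F i)) -> span G (\sum_(i <- r | P i) F i).
Proof. by move=> GF; elim/big_ind: _ => //; [apply: span0|apply: spanD]. Qed.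

(** A sum of infinite support is 0 by convention, which also lies in the span. *)
Lemma span_fsum (V : lmodType K) (G : V -> Prop) (I : choiceType) (A : set I) F :
  (forall i, A i -> span G (F i)) -> span G (\sum_(i \in A) F i).
Proof.
move=> GF; case: finite_supportP => [_|X XA _ _]; first by rewrite big_nil; apply: span0.
by rewrite big_seq; apply: span_sum => i /XA /GF.
Qed.

Lemma span_map (V W : lmodType K) (f : {linear V -> W}) (G : V -> Prop)
    (H : W -> Prop) v :
  (forall g, G g -> span H (f g)) -> span G v -> span H (f v).
Proof.
move=> fG; elim=> [|a g w Gg _ IH]; first by rewrite linear0; apply: span0.
by rewrite linearP; apply/spanD => //; apply/spanZ/fG.
Qed.

Lemma span_trans (V : lmodType K) (G H : V -> Prop) v :
  (forall g, G g -> span H g) -> span G v -> span H v.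
Proof. exact: (@span_map V V idfun). Qed.

Lemma spanP (V : lmodType K) I (F : I -> V) v :
  span (fun u => exists i, u = F i) v <->
  exists s : seq (K * I), v = \sum_(t <- s) t.1 *: F t.2.
Proof.
split=> [|[s ->]]; last by apply: span_sum => t _; apply/spanZ/span_gen; exists t.2.
elim=> [|a g w [i ->] _ [s ->]]; first by exists [::]; rewrite big_nil.
by exists ((a, i) :: s); rewrite big_cons.
Qed.

End Span.

Section Fock.
Variable C : fieldType.
Local Notation VP := (VP C).
Implicit Types (v w : VP) (f : monomial) (mu : weight).

Lemma freegZ (a k : C) (b : monomial * weight) :
  a *: (<< k *g b >> : VP) = << (a * k) *g b >>.
Proof. by apply/eqP/freeg_eqP => x; rewrite coeffZ !coeffU mulrA. Qed.

Definition vcoef (b : monomial * weight) (v : VP) : C := coeff b v.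

Definition bvec (b : monomial * weight) : VP := << b >>.

Lemma bvecZ (a : C) b : << a *g b >> = a *: bvec b.
Proof. by rewrite /bvec freegZ mulr1. Qed.

Lemma VP_basis (v : VP) : v = \sum_(b <- dom v) vcoef b v *: bvec b.
Proof.
rewrite -[LHS]freeg_sumE; apply: eq_bigr => b _.
by rewrite bvecZ.
Qed.

(** Additivity comes from the universal property of the free group; homogeneity is checked on
    multiples of basis vectors and extended by additivity. *)
Lemma fglift_is_linear (F : monomial * weight -> VP) : linear (fglift F : VP -> VP).
Proof.
have addF : additive (fglift F : VP -> VP) := @lift_is_additive C _ VP F.
have [L LE] : exists L : {additive VP -> VP}, fglift F = L :> (VP -> VP).
  pose L : {additive VP -> VP} :=
    HB.pack (fglift F : VP -> VP) (GRing.isZmodMorphism.Build VP VP _ addF).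
  by exists L.
have LD (u v : VP) : L (u + v) = L u + L v by apply: raddfD.
have LU (k : C) b : L (k *: bvec b) = k *: F b by rewrite -LE -bvecZ; exact: liftU.
have LZ (a : C) (u : VP) : L (a *: u) = a *: L u.
  rewrite [u]VP_basis; elim: (dom u) => [|b s IH].
    by rewrite big_nil scaler0 raddf0 scaler0.
  rewrite big_cons scalerDr !LD scalerDr IH; congr (_ + _).
  by rewrite scalerA !LU scalerA.
by rewrite LE => a u v; rewrite LD LZ.
Qed.

Lemma fgliftU (F : monomial * weight -> VP) (k : C) b :
  fglift F (<< k *g b >> : VP) = k *: F b.
Proof. exact: liftU. Qed.

HB.instance Definition _ (n : int) :=
  GRing.isLinear.Build C VP VP *:%R (heis n) (fglift_is_linear _).
HB.instance Definition _ (l : weight) :=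
  GRing.isLinear.Build C VP VP *:%R (exp_op l) (fglift_is_linear _).
HB.instance Definition _ (l : weight) (q : rat) :=
  GRing.isLinear.Build C VP VP *:%R (xpow_op l q) (fglift_is_linear _).

End Fock.

(** * Exponentials of series of commuting operators *)

Lemma sum_triangle (V : nmodType) (k : nat) (F : nat -> nat -> V) :
  \sum_(i < k.+1) \sum_(j < (k - i).+1) F i j =
  \sum_(j < k.+1) \sum_(i < (k - j).+1) F i j.
Proof.
have widen (G : nat -> V) (i : 'I_k.+1) :
    \sum_(j < (k - i).+1) G j = \sum_(j < k.+1 | (j < (k - i).+1)%N) G j.
  by apply: big_ord_widen; rewrite ltnS leq_subr.
rewrite (eq_bigr _ (fun (i : 'I_k.+1) _ => widen (F i) i)).
rewrite [RHS](eq_bigr _ (fun (j : 'I_k.+1) _ => widen (F^~ j) j)).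
rewrite (exchange_big_dep xpredT) //=; apply: eq_bigr => j _; apply: eq_bigl => i /=.
by have := ltn_ord i; have := ltn_ord j; lia.
Qed.

Section SeriesExp.
Variable C : fieldType.
Hypothesis char0 : [pchar C] =i pred0.
Local Notation VP := (VP C).
Implicit Types (v w : VP) (k r : nat).

Lemma natC_neq0 (n : nat) : n.+1%:R != 0 :> C.
Proof. by have /pcharf0P -> := char0. Qed.

Definition linear_pack (f : VP -> VP) (lin_f : linear f) : {linear VP -> VP} :=
  HB.pack f (GRing.isLinear.Build C VP VP *:%R f lin_f).

Variable A : nat -> {linear VP -> VP}.
Hypothesis A0 : forall v, A 0 v = 0.
Hypothesis AC : forall i j v, A i (A j v) = A j (A i v).

Let AZ j (a : C) v : A j (a *: v) = a *: A j v.
Proof. exact: linearZ. Qed.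

Lemma series_pow_is_linear r k : linear (series_pow A r k).
Proof.
elim: r k => [|r IH] k a u v /=; first by case: eqP; rewrite ?scaler0 ?addr0.
rewrite scaler_sumr -big_split /=; apply: eq_bigr => j _.
by rewrite IH linearP.
Qed.

HB.instance Definition _ r k :=
  GRing.isLinear.Build C VP VP *:%R (series_pow A r k) (series_pow_is_linear r k).

Lemma series_exp_is_linear k : linear (series_exp A k).
Proof.
move=> a u v; rewrite /series_exp scaler_sumr -big_split /=; apply: eq_bigr => j _.
by rewrite linearP scalerDr !scalerA mulrC.
Qed.

Lemma series_pow_eq0 r k v : (k < r)%N -> series_pow A r k v = 0.
Proof.
elim: r k => // r IH k ltkr /=; rewrite big_ord_recl A0 add0r big1 // => j _.
by rewrite IH ?linear0 //= /bump; have := ltn_ord j; lia.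
Qed.

Lemma series_pow_comm (T : {linear VP -> VP}) r k v :
  (forall j u, T (A j u) = A j (T u)) -> T (series_pow A r k v) = series_pow A r k (T v).
Proof.
move=> TA; elim: r k => [|r IH] k /=; first by case: eqP; rewrite ?linear0.
by rewrite linear_sum; apply: eq_bigr => j _; rewrite /= TA IH.
Qed.

Lemma series_exp_comm (T : {linear VP -> VP}) k v :
  (forall j u, T (A j u) = A j (T u)) -> T (series_exp A k v) = series_exp A k (T v).
Proof.
move=> TA; rewrite linear_sum; apply: eq_bigr => j _.
by rewrite /= linearZ /= series_pow_comm.
Qed.

Lemma series_exp0 v : series_exp A 0 v = v.
Proof. by rewrite /series_exp big_ord1 /= invr1 scale1r. Qed.

Lemma series_expE N k v : (k < N)%N ->
  series_exp A k v = \sum_(r < N) (r`!%:R^-1 : C) *: series_pow A r k v.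
Proof.
move=> ltkN; rewrite /series_exp.
rewrite (big_ord_widen N (fun r => (r`!%:R^-1 : C) *: series_pow A r k v)) //.
rewrite big_mkcond; apply: eq_bigr => r _; case: ltnP => // ltkr.
by rewrite series_pow_eq0 ?scaler0.
Qed.

(** Coefficient of z^k in z d/dz A^(r+1) = (r+1) (z A') A^r, valid because the [A i] commute. *)
Lemma series_pow_rec r k v :
  k%:R *: series_pow A r.+1 k v =
  r.+1%:R *: \sum_(j < k.+1) j%:R *: A j (series_pow A r (k - j) v).
Proof.
elim: r k v => [|r IH] k v.
  rewrite scale1r /= scaler_sumr; apply: eq_bigr => -[j /= ltjk] _.
  by have [/eqP kj0|_] := eqVneq (k - j)%N 0%N; [congr (_%:R *: _); lia | rewrite !linear0].
rewrite [series_pow A r.+2 k v]/= scaler_sumr.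
(* Leibniz rule: the weight [k] splits into [j] for the first factor and [k - j] for the remaining
   power. *)
have splitk (j : 'I_k.+1) : true -> k%:R *: A j (series_pow A r.+1 (k - j) v) =
    j%:R *: A j (series_pow A r.+1 (k - j) v)
    + r.+1%:R *: \sum_(i < (k - j).+1) i%:R *: A i (A j (series_pow A r (k - i - j) v)).
  move=> _; have {1}-> : k = (j + (k - j))%N by have := ltn_ord j; lia.
  rewrite natrD scalerDl; congr (_ + _).
  rewrite -AZ IH AZ linear_sum; congr (_ *: _); apply: eq_bigr => i _ /=.
  by rewrite AZ AC subnAC.
rewrite (eq_bigr _ splitk) big_split /= -scaler_sumr.
rewrite (sum_triangle k (fun j i => i%:R *: A i (A j (series_pow A r (k - i - j) v)))).
rewrite [in RHS]mulrSr addrC scalerDl scale1r; congr (_ *: _ + _).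
by apply: eq_bigr => i _; rewrite -scaler_sumr -linear_sum.
Qed.

(** Coefficient of z^k in z E' = (z A') E for E = exp A; the commutators with E are later found by
    induction along this recursion. *)
Lemma series_exp_rec k v :
  k%:R *: series_exp A k v = \sum_(j < k.+1) j%:R *: A j (series_exp A (k - j) v).
Proof.
case: k => [|k]; first by rewrite big_ord1 !scale0r.
rewrite {1}/series_exp big_ord_recl /= scaler0 add0r scaler_sumr.
have step (r : 'I_k.+1) : true ->
    k.+1%:R *: (((bump 0 r)`!)%:R^-1 *: series_pow A (bump 0 r) k.+1 v) =
    \sum_(j < k.+2) j%:R *: A j ((r`!)%:R^-1 *: series_pow A r (k.+1 - j) v).
  move=> _; rewrite scalerA mulrC -scalerA series_pow_rec scalerA.
  rewrite /bump /= add1n factS natrM invfM mulrAC mulVf ?natC_neq0 // mul1r.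
  rewrite scaler_sumr; apply: eq_bigr => j _.
  by rewrite AZ !scalerA mulrC.
(* The factor [j%:R] kills [j = 0]; for positive [j] the degree [k.+1 - j] is at most [k], so the
   powers [r < k.+1] suffice. *)
rewrite (eq_bigr _ step) exchange_big /=; apply: eq_bigr => -[[|j] /= ltj] _.
  by rewrite scale0r big1 // => i _; rewrite scale0r.
by rewrite -scaler_sumr -linear_sum (@series_expE k.+1) //= ; lia.
Qed.

End SeriesExp.

(** * The Heisenberg relations *)

Section Heisenberg.
Variable C : fieldType.
Local Notation VP := (VP C).
Implicit Types (v w : VP) (b : monomial * weight) (l : weight) (i j : nat).

Lemma bvec_ext (V : lmodType C) (f g : {linear VP -> V}) :
  (forall b, f (bvec C b) = g (bvec C b)) -> f =1 g.
Proof.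
move=> fg v; rewrite [v]VP_basis !linear_sum; apply: eq_bigr => b _.
by rewrite !linearZ_LR /= fg.
Qed.

Lemma heis_neg_bvec i b :
  heis (Negz i) (bvec C b) = bvec C (mulcm b.1 (ucm i), b.2).
Proof. by rewrite /heis fgliftU scale1r. Qed.

Lemma heis_pos_bvec i b :
  heis (Posz i.+1) (bvec C b) =
  (2 * i.+1 * b.1 i)%:R *: bvec C (divcm b.1 (ucm i), b.2).
Proof. by rewrite /heis fgliftU scale1r bvecZ. Qed.

Lemma exp_op_bvec l b : exp_op l (bvec C b) = bvec C (b.1, l + b.2).
Proof. by rewrite /exp_op fgliftU scale1r. Qed.

Lemma heis_neg_neg i j v :
  heis (Negz i) (heis (Negz j) v) = heis (Negz j) (heis (Negz i) v).
Proof.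
apply: (bvec_ext (f := heis (Negz i) \o heis (Negz j))
                 (g := heis (Negz j) \o heis (Negz i))) => b /=.
rewrite !heis_neg_bvec /=; congr (bvec _ (_, _)).
by apply/eqP/cmP => k; rewrite !mulcmE addnAC.
Qed.

Lemma heis_pos_pos i j v :
  heis (Posz i.+1) (heis (Posz j.+1) v) = heis (Posz j.+1) (heis (Posz i.+1) v).
Proof.
apply: (bvec_ext (f := heis (Posz i.+1) \o heis (Posz j.+1))
                 (g := heis (Posz j.+1) \o heis (Posz i.+1))) => b /=.
rewrite !heis_pos_bvec !linearZ_LR /= !heis_pos_bvec /= !scalerA -!natrM.
rewrite !divcmE !ucmE; congr (_%:R *: bvec _ (_, _)).
  by rewrite [i == j]eq_sym; case: eqVneq => [->//|_]; rewrite !subn0 mulnC.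
by apply/eqP/cmP => k; rewrite !divcmE subnAC.
Qed.

Lemma heis_pos_neg i j v :
  heis (Posz i.+1) (heis (Negz j) v) =
  heis (Negz j) (heis (Posz i.+1) v) + (if i == j then 2 * i.+1 else 0)%:R *: v.
Proof.
pose c : C := (if i == j then 2 * i.+1 else 0)%:R.
apply: (bvec_ext (f := heis (Posz i.+1) \o heis (Negz j))
         (g := (heis (Negz j) \o heis (Posz i.+1)) \+ (c \*: idfun))) => b /=.
rewrite !(heis_pos_bvec, heis_neg_bvec, linearZ_LR) /= heis_neg_bvec /= mulcmE ucmE /c.
have [<-|ne_ij] := eqVneq i j.
  have -> : divcm (mulcm b.1 (ucm i)) (ucm i) = b.1.
    by apply/eqP/cmP => k; rewrite divcmE mulcmE addnK.
  (* [divcm] truncates when the variable is absent, but then the factor [b.1 i] is 0. *)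
  rewrite -surjective_pairing; case Ebi: (b.1 i) => [|n].
    by rewrite muln0 scale0r add0r add0n muln1.
  have -> : mulcm (divcm b.1 (ucm i)) (ucm i) = b.1.
    apply/eqP/cmP => k; rewrite mulcmE divcmE subnK // ucmE.
    by case: eqP => // <-; rewrite Ebi.
  by rewrite -surjective_pairing -scalerDl -natrD; congr (_%:R *: _); lia.
rewrite scale0r addr0 addn0; case Ebi: (b.1 i) => [|n].
  by rewrite muln0 !scale0r.
congr (_ *: bvec _ (_, _)); apply/eqP/cmP => k; rewrite !(divcmE, mulcmE, ucmE).
by have [<-|] := eqVneq i k; [rewrite eq_sym (negPf ne_ij)|]; lia.
Qed.

Lemma exp_op_heis_neg l i v : exp_op l (heis (Negz i) v) = heis (Negz i) (exp_op l v).
Proof.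
apply: (bvec_ext (f := exp_op l \o heis (Negz i)) (g := heis (Negz i) \o exp_op l)) => b /=.
by rewrite exp_op_bvec !heis_neg_bvec exp_op_bvec.
Qed.

Lemma exp_op_exp_vec l m : exp_op l (exp_vec C m) = exp_vec C (l + m).
Proof. exact: exp_op_bvec. Qed.

Lemma exp_opK l : cancel (exp_op l) (exp_op (- l) : VP -> VP).
Proof.
move=> v; apply: (bvec_ext (f := exp_op (- l) \o exp_op l) (g := idfun)) => b /=.
by rewrite !exp_op_bvec /= addKr -surjective_pairing.
Qed.

Lemma heis_pos_exp_vec i m : heis (Posz i.+1) (exp_vec C m) = 0.
Proof. by rewrite [LHS]heis_pos_bvec onecmE muln0 scale0r. Qed.

End Heisenberg.

(** * Recursions for the coefficients of E^- and E^+ *)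

Section Modes.
Variable C : fieldType.
Hypothesis char0 : [pchar C] =i pred0.
Local Notation VP := (VP C).
Implicit Types (v w : VP) (l : weight) (i j k : nat).

Let EminusA l k : VP -> VP := fun v =>
  if k == 0%N then 0 else ((- k%:R)^-1 : C) *: lattice_mode l (- k%:Z) v.
Let EplusA l k : VP -> VP := fun v =>
  if k == 0%N then 0 else (k%:R^-1 : C) *: lattice_mode l k%:Z v.

Let scale_heis_linear (a b : C) (n : int) :
  linear (fun v => a *: (b *: heis n v)).
Proof. by move=> c u v; rewrite linearP !scalerDr !scalerA [_ * c]mulrC mulrA. Qed.

Let linear_scale2 (T : {linear VP -> VP}) (a b : C) v : T (a *: (b *: v)) = a *: (b *: T v).
Proof. by rewrite scalerA linearZ_LR scalerA. Qed.

Let EminusA_linear l k : linear (EminusA l k).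
Proof.
rewrite /EminusA; case: (k == 0%N); last exact: scale_heis_linear.
by move=> a u v; rewrite scaler0 addr0.
Qed.

Let EplusA_linear l k : linear (EplusA l k).
Proof.
rewrite /EplusA; case: (k == 0%N); last exact: scale_heis_linear.
by move=> a u v; rewrite scaler0 addr0.
Qed.

Let EmA l k : {linear VP -> VP} := linear_pack (EminusA_linear l k).
Let EpA l k : {linear VP -> VP} := linear_pack (EplusA_linear l k).

HB.instance Definition _ l k := GRing.isLinear.Build C VP VP *:%R (Eminus l k)
  (series_exp_is_linear (EmA l) k).
HB.instance Definition _ l k := GRing.isLinear.Build C VP VP *:%R (Eplus l k)
  (series_exp_is_linear (EpA l) k).

Let EmAS l k v : EmA l k.+1 v =
  ((- k.+1%:R)^-1 : C) *: ((l%:~R / 2%:R : C) *: heis (Negz k) v).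
Proof. by []. Qed.

Let EpAS l k v : EpA l k.+1 v =
  (k.+1%:R^-1 : C) *: ((l%:~R / 2%:R : C) *: heis (Posz k.+1) v).
Proof. by []. Qed.

Let EmA0 l v : EmA l 0 v = 0. Proof. by []. Qed.

Let EpA0 l v : EpA l 0 v = 0. Proof. by []. Qed.

Lemma Eminus0 l v : Eminus l 0 v = v.
Proof. exact: (series_exp0 (EmA l)). Qed.

Lemma Eplus0 l v : Eplus l 0 v = v.
Proof. exact: (series_exp0 (EpA l)). Qed.

Lemma Eminus_comm l (T : {linear VP -> VP}) k v :
  (forall i u, T (heis (Negz i) u) = heis (Negz i) (T u)) ->
  T (Eminus l k v) = Eminus l k (T v).
Proof.
move=> Th; apply: (series_exp_comm (A := EmA l)) => -[|j] u; first exact: linear0.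
by rewrite !EmAS linear_scale2 Th.
Qed.

Let EmA_comm l i j v : EmA l i (EmA l j v) = EmA l j (EmA l i v).
Proof.
case: i => [|i]; first by rewrite !EmA0 linear0.
case: j => [|j]; first by rewrite !EmA0 linear0.
rewrite !EmAS !(linear_scale2 (heis _)) /= heis_neg_neg !scalerA; congr (_ *: _).
by congr (_ * _); rewrite mulrC mulrA mulrAC.
Qed.

Let EpA_comm l i j v : EpA l i (EpA l j v) = EpA l j (EpA l i v).
Proof.
case: i => [|i]; first by rewrite !EpA0 linear0.
case: j => [|j]; first by rewrite !EpA0 linear0.
rewrite !EpAS !(linear_scale2 (heis _)) /= heis_pos_pos !scalerA; congr (_ *: _).
by congr (_ * _); rewrite mulrC mulrA mulrAC.
Qed.

Lemma Eminus_rec l k v : k.+1%:R *: Eminus l k.+1 v =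
  (- (l%:~R / 2%:R) : C) *: \sum_(j < k.+1) heis (Negz j) (Eminus l (k - j) v).
Proof.
rewrite [LHS](series_exp_rec char0 (@EmA0 l) (@EmA_comm l)).
rewrite big_ord_recl scale0r add0r scaler_sumr; apply: eq_bigr => -[j /= ltj] _.
rewrite /bump leq0n add1n -[EminusA l j.+1 _]/(EmA l j.+1 _) EmAS subSS !scalerA; congr (_ *: _).
by rewrite invrN mulrA mulrN divff ?natC_neq0 // mulN1r.
Qed.

Lemma Eplus_rec l k v : k.+1%:R *: Eplus l k.+1 v =
  (l%:~R / 2%:R : C) *: \sum_(j < k.+1) heis (Posz j.+1) (Eplus l (k - j) v).
Proof.
rewrite [LHS](series_exp_rec char0 (@EpA0 l) (@EpA_comm l)).
rewrite big_ord_recl scale0r add0r scaler_sumr; apply: eq_bigr => -[j /= ltj] _.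
rewrite /bump leq0n add1n -[EplusA l j.+1 _]/(EpA l j.+1 _) EpAS subSS !scalerA; congr (_ *: _).
by rewrite mulrA divff ?natC_neq0 // mul1r.
Qed.

(** Extending the coefficients by 0 to negative indices spares the commutation relations their
    boundary cases. *)
Definition zext (E : nat -> VP -> VP) (n : int) (v : VP) : VP :=
  if n is Posz k then E k v else 0.

Arguments zext : simpl never.

Lemma zext_lt0 E n v : n < 0 -> zext E n v = 0.
Proof. by case: n. Qed.

Lemma zext_linear (E : nat -> {linear VP -> VP}) n : linear (zext E n).
Proof. by case: n => k a u v; rewrite /zext /=  ?linearP // scaler0 addr0. Qed.

HB.instance Definition _ l n := GRing.isLinear.Build C VP VP *:%R (zext (Eminus l) n)
  (zext_linear (Eminus l) n).
HB.instance Definition _ l n := GRing.isLinear.Build C VP VP *:%R (zext (Eplus l) n)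
  (zext_linear (Eplus l) n).

Lemma zext_sum E (h : nat -> {linear VP -> VP}) N k v : (k < N)%N ->
  \sum_(j < N) h j (zext E (Posz k - Posz j) v) = \sum_(j < k.+1) h j (E (k - j)%N v).
Proof.
move=> ltkN; rewrite (big_ord_widen N (fun j => h j (E (k - j)%N v))) //.
rewrite [RHS]big_mkcond; apply: eq_bigr => j _; case: ltnP => ltj.
  by rewrite subzn.
by rewrite zext_lt0 ?linear0 //; lia.
Qed.

(** Summands with [j >= n] vanish, so any bound [N] will do; recursions at different [n] can then
    share one index range. *)
Lemma zEminus_rec l N (n : int) v : n <= N%:Z -> n%:~R *: zext (Eminus l) n v =
  (- (l%:~R / 2%:R) : C) *:
  \sum_(j < N) heis (Negz j) (zext (Eminus l) (n - 1 - Posz j) v).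
Proof.
case: n => [[|k]|k] lenN.
- by rewrite scale0r big1 ?scaler0 // => j _; rewrite zext_lt0 ?linear0 //; lia.
- rewrite -[k.+1%:~R]/(k.+1%:R) /zext -/zext Eminus_rec; congr (_ *: _).
  have -> : Posz k.+1 - 1 = k by lia.
  by rewrite (zext_sum (Eminus l) (fun j => heis (Negz j))).
- by rewrite scaler0 big1 ?scaler0 // => j _; rewrite zext_lt0 ?linear0 //; lia.
Qed.

Lemma zEplus_rec l N (n : int) v : n <= N%:Z -> n%:~R *: zext (Eplus l) n v =
  (l%:~R / 2%:R : C) *:
  \sum_(j < N) heis (Posz j.+1) (zext (Eplus l) (n - 1 - Posz j) v).
Proof.
case: n => [[|k]|k] lenN.
- by rewrite scale0r big1 ?scaler0 // => j _; rewrite zext_lt0 ?linear0 //; lia.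
- rewrite -[k.+1%:~R]/(k.+1%:R) /zext -/zext Eplus_rec; congr (_ *: _).
  have -> : Posz k.+1 - 1 = k by lia.
  by rewrite (zext_sum (Eplus l) (fun j => heis (Posz j.+1))).
- by rewrite scaler0 big1 ?scaler0 // => j _; rewrite zext_lt0 ?linear0 //; lia.
Qed.

End Modes.

(** * Commutation of h(i) and E^+ with E^- *)

Section Commutators.
Variable C : fieldType.
Hypothesis char0 : [pchar C] =i pred0.
Local Notation VP := (VP C).
Implicit Types (v w : VP) (l mu : weight) (i j k : nat) (r : seq nat).

Let two_neq0 : 2%:R != 0 :> C := natC_neq0 char0 1.

(** [Em n] is multiplication by S_n, the coefficient of z^n in exp (sum_m h(-m) z^m / m). *)
Local Notation Em n := (zext (C := C) (Eminus (- alpha)) n).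
Local Notation Ep n := (zext (C := C) (Eplus (- half_alpha)) n).

Let linZ (T : {linear VP -> VP}) (a : C) v : T (a *: v) = a *: T v.
Proof. exact: linearZ_LR. Qed.

Let linD (T : {linear VP -> VP}) v w : T (v + w) = T v + T w.
Proof. exact: linearD. Qed.

Let linB (T : {linear VP -> VP}) v w : T (v - w) = T v - T w.
Proof. exact: linearB. Qed.

Lemma Em_rec N (n : int) v : n <= N%:Z ->
  n%:~R *: Em n v = \sum_(j < N) heis (Negz j) (Em (n - 1 - Posz j) v).
Proof.
move=> lenN; rewrite (zEminus_rec char0 _ v lenN) /alpha -mulNr -rmorphN opprK.
by rewrite divff ?scale1r.
Qed.

(* [h(i + 1), exp (sum_m h(-m) z^m / m)] = 2 z^(i + 1) exp (sum_m h(-m) z^m / m) *)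
Lemma heis_Em i (n : int) v :
  heis (Posz i.+1) (Em n v) = Em n (heis (Posz i.+1) v) + 2%:R *: Em (n - Posz i.+1) v.
Proof.
case: n => [k|k]; last by rewrite linear0 add0r zext_lt0 ?scaler0 //; lia.
elim/ltn_ind: k => -[|k] IH.
  by rewrite /zext /= !Eminus0 scaler0 addr0.
apply: (scalerI (natC_neq0 char0 k)).
rewrite -(linZ (heis _)) -[k.+1%:R]/((Posz k.+1)%:~R) scalerDr.
(* [N] bounds [k.+1], as the recursion demands, and exceeds [i], so that the diagonal term is
   present. *)
pose N := (k.+1 + i.+1)%N.
rewrite !(@Em_rec N) /N; try lia.
rewrite linear_sum.
have step (j : 'I_N) : true -> heis i.+1 (heis (Negz j) (Em (Posz k.+1 - 1 - Posz j) v)) =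
    heis (Negz j) (Em (Posz k.+1 - 1 - Posz j) (heis i.+1 v))
    + (2%:R *: heis (Negz j) (Em (Posz k.+1 - Posz i.+1 - 1 - Posz j) v)
    + (if i == j then 2 * i.+1 else 0)%:R *: Em (Posz k.+1 - 1 - Posz j) v).
  move=> _; rewrite heis_pos_neg addrA; congr (_ + _).
  have -> : Posz k.+1 - 1 - Posz j = Posz k - Posz j by lia.
  have -> : Posz k.+1 - Posz i.+1 - 1 - Posz j = Posz k - Posz j - Posz i.+1 by lia.
  have [ltkj|lejk] := ltnP k j.
    by rewrite !zext_lt0 ?linear0 ?scaler0 ?addr0 //; lia.
  rewrite subzn // IH; last by lia.
  by rewrite (linD (heis _)) (linZ (heis _)).
rewrite (eq_bigr _ step) !big_split /=; congr (_ + _).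
(* The part [k.+1 - i.+1] rebuilds the recursion at the shifted index; the part [i.+1] is the single
   term [j = i] of the Heisenberg bracket. *)
have -> : (Posz k.+1)%:~R = (Posz k.+1 - Posz i.+1)%:~R + i.+1%:R :> C.
  by rewrite -[i.+1%:R]/((Posz i.+1)%:~R) -intrD subrK.
rewrite scalerDl; congr (_ + _).
  by rewrite scalerA mulrC -scalerA (@Em_rec N) ?scaler_sumr /N //; lia.
have ltiN : (i < N)%N by rewrite /N; lia.
rewrite scalerA -natrM (bigD1 (Ordinal ltiN)) //= eqxx big1 ?addr0 => [|j ne_ji].
  by rewrite mulnC; congr (_ *: Em _ v); lia.
by rewrite ifN ?scale0r //; apply: contraNneq ne_ji => ij; apply/eqP/val_inj.
Qed.

(* exp (- sum_m h(m) x^-m / (2 m)) exp (sum_m h(-m) z^m / m), reordered, picks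
   up the factor 1 - z / x. *)
Lemma Ep_Em (m n : int) v :
  Ep m (Em n v) = Em n (Ep m v) - Em (n - 1) (Ep (m - 1) v).
Proof.
case: m => [k|k]; last by rewrite !(zext_lt0 (Eplus _)) ?linear0 ?addr0 //; lia.
elim/ltn_ind: k n v => -[|k] IH n v.
  by rewrite [Ep (0 - 1) v]zext_lt0 // linear0 subr0 /zext !Eplus0.
have addBD (x y z t : VP) : x + y - (z + t) = x - z + (y - t).
  by rewrite opprD addrACA.
pose T j := Em (n - Posz j) (Ep (Posz k.+1 - Posz j) v).
pose c : C := (- half_alpha)%:~R / 2%:R.
have c2 : c * 2%:R = -1 by rewrite /c divfK.
have Ep_rec N (i : int) u : i <= N%:Z ->
    i%:~R *: Ep i u = c *: \sum_(j < N) heis (Posz j.+1) (Ep (i - 1 - Posz j) u).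
  exact: zEplus_rec.
apply: (scalerI (natC_neq0 char0 k)).
rewrite -[k.+1%:R]/((Posz k.+1)%:~R) (@Ep_rec k.+1) //.
have step (j : 'I_k.+1) : true ->
    heis (Posz j.+1) (Ep (Posz k.+1 - 1 - Posz j) (Em n v)) =
    Em n (heis (Posz j.+1) (Ep (Posz k.+1 - 1 - Posz j) v))
    - Em (n - 1) (heis (Posz j.+1) (Ep (Posz k.+1 - 1 - 1 - Posz j) v))
    - 2%:R *: (T j.+2 - T j.+1).
  move=> _; have ltjk := ltn_ord j.
  have -> : Posz k.+1 - 1 - Posz j = Posz (k - j) by lia.
  rewrite IH; last by lia.
  rewrite (linB (heis _)) /= !heis_Em.
  have -> : Posz (k - j) - 1 = Posz k.+1 - 1 - 1 - Posz j by lia.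
  rewrite addBD; congr (_ + _); rewrite -scalerBr -scalerN opprB /T.
  rewrite -[Eplus _ (k - j) v]/(Ep (Posz (k - j)) v).
  by congr (_ *: (_ - _)); congr (zext _ _ (zext _ _ _)); lia.
rewrite (eq_bigr _ step) !big_split !sumrN -scaler_sumr.
(* The corrections telescope to [- T 1], as [T k.+2] contains [Ep (-1) = 0]; since [c * 2 = -1],
   they raise the factor [k] of the second sum to [k.+1]. *)
rewrite -(big_mkord xpredT (fun j => T j.+2 - T j.+1)) telescope_sumr //.
rewrite {1}/T [Ep (_ - Posz k.+2) v]zext_lt0 ?linear0 ?sub0r; last by lia.
rewrite -!linear_sum !scalerDr -!(linZ (zext _ _)) scalerN.
rewrite -(linZ (zext _ _)) -!Ep_rec; try lia.
rewrite scalerN scalerA c2 scaleN1r opprK /T !(linZ (zext _ _)).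
rewrite -addrA -scalerN; congr (_ + _).
have -> : Posz k.+1 - 1 = Posz k by lia.
rewrite !scalerN -opprD; congr (- _).
by rewrite -[k.+1%:~R]/(k.+1%:R) mulrSr scalerDl scale1r.
Qed.

End Commutators.

(** * Products of complete symmetric functions *)

Section Schur.
Variable C : fieldType.
Hypothesis char0 : [pchar C] =i pred0.
Local Notation VP := (VP C).
Implicit Types (v w : VP) (l mu : weight) (i j k : nat) (r : seq nat).

Local Notation Em n := (zext (C := C) (Eminus (- alpha)) n).
Local Notation Ep n := (zext (C := C) (Eplus (- half_alpha)) n).

(** The product S_r1 ... S_rk of complete symmetric functions, tensored with e^mu; it is not the
    Schur function of the partition [r]. *)
Definition schur mu r : VP := foldr (Eminus (- alpha)) (exp_vec C mu) r.

Lemma schur_perm mu r r' : perm_eq r r' -> schur mu r = schur mu r'.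
Proof.
have Ecomm i j v : Eminus (- alpha) i (Eminus (- alpha) j v) =
    Eminus (- alpha) j (Eminus (- alpha) i v).
  apply: Eminus_comm => i1 u; symmetry.
  by apply: (@Eminus_comm _ _ (heis (Negz i1))) => i2 w; apply: heis_neg_neg.
move: r r'; apply: catCA_perm_subst => s1 s2 s3; rewrite /schur !foldr_cat.
move: (foldr _ _ s3) => u; elim: s1 => //= i s1 ->.
by elim: s2 => //= j s2 <-; apply: Ecomm.
Qed.

(** Serves for e^lambda, the projections in x^lambda and e^(i pi alpha / 2), which all commute with
    the creation modes. *)
Lemma schur_map (T : {linear VP -> VP}) (c : C) mu mu' r :
  (forall i u, T (heis (Negz i) u) = heis (Negz i) (T u)) ->
  T (exp_vec C mu) = c *: exp_vec C mu' -> T (schur mu r) = c *: schur mu' r.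
Proof.
move=> Th Te; elim: r => //= i r IH.
by rewrite Eminus_comm // IH linearZ_LR.
Qed.

Lemma exp_op_schur l mu r : exp_op l (schur mu r) = schur (l + mu) r.
Proof.
rewrite -[RHS]scale1r; apply: (@schur_map (exp_op l)) => [i u|].
  exact: exp_op_heis_neg.
by rewrite scale1r [LHS]exp_op_exp_vec.
Qed.

Lemma xpow_op_schur l q mu r :
  xpow_op l q (schur mu r) = if pairing l mu == q then schur mu r else 0.
Proof.
rewrite (@schur_map (xpow_op l q) (pairing l mu == q)%:R mu mu).
- by case: eqP; rewrite ?scale1r ?scale0r.
- move=> i u.
  apply: (bvec_ext (f := xpow_op l q \o heis (Negz i)) (g := heis (Negz i) \o xpow_op l q)) => b /=.
  rewrite heis_neg_bvec /xpow_op !fgliftU !scale1r /=.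
  by case: eqP => _; rewrite ?linear0 // heis_neg_bvec.
- rewrite [LHS]fgliftU scale1r /=.
  by case: eqP; rewrite ?scale1r ?scale0r.
Qed.

(** The degree is an integer, so that lowering operators may make it negative; the layer is then
    empty. *)
Definition layer mu k (d : int) (u : VP) : Prop :=
  exists2 r, size r = k /\ (sumn r)%:Z = d & u = schur mu r.

Lemma Em_layer mu k d (n : int) v :
  span (layer mu k d) v -> span (layer mu k.+1 (d + n)) (Em n v).
Proof.
case: n => n; last by rewrite zext_lt0 // => _; apply: span0.
apply: span_map => u [r [sz_r sum_r] ->].
by apply: span_gen; exists (n :: r) => //=; rewrite sz_r; split => //; lia.
Qed.

(** By the Leibniz rule h(i + 1) replaces one factor S_n at a time by 2 S_(n - i - 1), keeping the
    number of factors. *)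
Lemma heis_layer mu k d i v :
  span (layer mu k d) v -> span (layer mu k (d - Posz i.+1)) (heis (Posz i.+1) v).
Proof.
apply: span_map => u [r [<- <-] ->] {u v k d}.
elim: r => [|n r IH]; first by rewrite /schur /= heis_pos_exp_vec; apply: span0.
rewrite -[X in span _ X]/(heis (Posz i.+1) (Em (Posz n) (schur mu r))) heis_Em //=.
have split_sum : (n + sumn r)%:Z - i.+1%:Z = (sumn r)%:Z - i.+1%:Z + Posz n by lia.
apply: spanD; first by rewrite split_sum; apply: Em_layer.
have -> : (n + sumn r)%:Z - i.+1%:Z = (sumn r)%:Z + (Posz n - i.+1%:Z) by lia.
by apply/spanZ/Em_layer/span_gen; exists r.
Qed.

Lemma Eplus_layer l mu k d j v :
  span (layer mu k d) v -> span (layer mu k (d - Posz j)) (Eplus l j v).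
Proof.
elim/ltn_ind: j => -[|j] IH Gv; first by rewrite Eplus0 subr0.
rewrite -[Eplus _ _ _]scale1r -(mulVf (natC_neq0 char0 j)) -scalerA Eplus_rec //.
apply/spanZ/spanZ/span_sum => i _; have ltij := ltn_ord i.
have -> : d - Posz j.+1 = d - Posz (j - i) - Posz i.+1 by lia.
by apply/heis_layer/IH => //; lia.
Qed.

Lemma layer_lt0 mu k d v : d < 0 -> span (layer mu k d) v -> v = 0.
Proof.
move=> d_lt0; elim=> // a g w [r [_ sum_r] _].
by move: d_lt0; rewrite -sum_r.
Qed.

Lemma Eplus_schur_eq0 l mu k r : (sumn r < k)%N -> Eplus l k (schur mu r) = 0.
Proof.
move=> lt_k; apply: (@layer_lt0 mu (size r) ((sumn r)%:Z - Posz k)); first by lia.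
by apply/Eplus_layer/span_gen; exists r.
Qed.

(** On k factors E^+(-alpha/2, x) acts through the product of the 1 - z_i / x, of degree k in 1 /
    x. *)
Lemma Ep_schur_eq0 mu k r : (size r < k)%N -> Eplus (- half_alpha) k (schur mu r) = 0.
Proof.
suff H n : (size r)%:Z < n -> Ep n (schur mu r) = 0 by move=> ltk; apply: (H k%:Z).
elim: r n => [|i r IH] n /= lt_n.
  by case: n lt_n => // p lt_n; exact: (@Eplus_schur_eq0 _ mu p [::]).
rewrite -[X in zext _ _ X]/(Em (Posz i) (schur mu r)) Ep_Em // !IH; try lia.
by rewrite [X in X - _]linear0 [X in _ - X]linear0 subr0.
Qed.

(** The top coefficient of that product is (-1)^k z_1 ... z_k, and multiplication by z_i turns S_r
    into S_(r - 1), with S_(-1) = 0. *)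
Lemma Ep_schur_top mu r : Eplus (- half_alpha) (size r) (schur mu r) =
  (-1) ^+ size r *: (if 0%N \in r then 0 else schur mu (map predn r)).
Proof.
elim: r => [|i r IH]; first by rewrite Eplus0 scale1r.
rewrite -[LHS]/(Ep (Posz (size r).+1) (Em (Posz i) (schur mu r))) Ep_Em //.
have -> : Posz (size r).+1 - 1 = Posz (size r) by lia.
rewrite [Ep (Posz (size r).+1) _]Ep_schur_eq0 // [X in X - _]linear0 sub0r.
rewrite [Ep (Posz (size r)) _]IH linearZ_LR exprS mulN1r scaleNr; congr (- (_ *: _)).
case: i => [|i]; first by rewrite inE eqxx [LHS]zext_lt0.
rewrite inE (_ : Posz i.+1 - 1 = Posz i); last by lia.
by case: (0%N \in r); [exact: linear0 | ].
Qed.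

End Schur.

(** * Vertex operators *)

Section Vertex.
Variable C : fieldType.
Hypothesis char0 : [pchar C] =i pred0.
Local Notation VP := (VP C).
Implicit Types (v w : VP) (l mu : weight) (q : rat) (i j k n : nat) (r : seq nat).

(** Each summand of [vertex_coef] is linear; the finitely supported sum is shown to be additive only
    on vectors whose summands vanish outside a box. *)
Definition vertex_term l q (jk : nat * nat) : VP -> VP :=
  Eminus (- l) jk.1 \o Eplus (- l) jk.2 \o exp_op l \o
    xpow_op l (q - jk.1%:R + jk.2%:R).

HB.instance Definition _ l q jk := GRing.Linear.on (vertex_term l q jk).

Let termP l q jk (a : C) v w : vertex_term l q jk (a *: v + w) =
  a *: vertex_term l q jk v + vertex_term l q jk w.
Proof. exact: linearP. Qed.

Lemma vertex_term_schur l q jk mu r : vertex_term l q jk (schur C mu r) =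
  if pairing l mu == q - jk.1%:R + jk.2%:R
  then Eminus (- l) jk.1 (Eplus (- l) jk.2 (schur C (l + mu) r)) else 0.
Proof.
rewrite /vertex_term /= xpow_op_schur; case: eqP => _; last by rewrite !linear0.
by rewrite exp_op_schur.
Qed.

Definition box n : seq (nat * nat) := [seq (j, k) | j <- iota 0 n, k <- iota 0 n].

Lemma mem_box n jk : (jk \in box n) = (jk.1 < n)%N && (jk.2 < n)%N.
Proof.
apply/allpairsP/andP => [[[j k] /= [+ + ->]]|[ltj ltk]].
  by rewrite !mem_iota.
by exists jk; rewrite !mem_iota -surjective_pairing.
Qed.

Lemma box_uniq n : uniq (box n).
Proof. by apply: allpairs_uniq; rewrite ?iota_uniq // => -[? ?] [? ?]. Qed.

Definition vertex_bounded l q n v :=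
  forall jk, jk \notin box n -> vertex_term l q jk v = 0.

Lemma vertex_bounded_le l q n n' v : (n <= n')%N ->
  vertex_bounded l q n v -> vertex_bounded l q n' v.
Proof.
move=> le_n bv jk jk_out; apply: bv; apply: contra jk_out.
by rewrite !mem_box => /andP[lt1 lt2]; rewrite !(leq_trans _ le_n).
Qed.

Lemma vertex_coefE l q n v : vertex_bounded l q n v ->
  vertex_coef l q v = \sum_(jk <- box n) vertex_term l q jk v.
Proof.
move=> bv; rewrite fsbig_seq ?box_uniq //.
by apply/esym/fsbig_widen => // jk [_ /= /negP]; apply: bv.
Qed.

(** The degree bounds [jk.2] by [sumn r], and the power of x fixes [jk.1 - jk.2] as
    [q - pairing l mu]. *)
Lemma vertex_bounded_schur l q mu r :
  exists n, vertex_bounded l q n (schur C mu r).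
Proof.
pose x := q - pairing l mu; exists (Num.bound `|x| + (sumn r).+1)%N => jk.
rewrite mem_box vertex_term_schur negb_and -!leqNgt.
have [le2|lt2] := leqP jk.2 (sumn r); last first.
  by rewrite Eplus_schur_eq0 ?linear0 ?if_same.
case: eqP => // pE /orP[le1|]; last by lia.
have := archi_boundP (normr_ge0 x); move: (Num.bound _) le1 => B leB.
suff : B%:R <= `|x| by move=> /le_lt_trans H /H; rewrite ltxx.
apply: le_trans (ler_norm x).
have -> : x = jk.1%:R - jk.2%:R by rewrite /x pE; ring.
by rewrite lerBrDr -natrD ler_nat (leq_trans _ leB) // leq_add2l ltnW.
Qed.

Lemma vertex_bounded_span l q (G : VP -> Prop) v :
  (forall u, G u -> exists n, vertex_bounded l q n u) -> span G v ->
  exists n, vertex_bounded l q n v.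
Proof.
move=> bG; elim=> [|a u w Gu _ [n bw]].
  by exists 0 => jk _; rewrite linear0.
have [n' bu] := bG u Gu; exists (maxn n n') => jk jk_out.
rewrite termP (vertex_bounded_le (leq_maxl n n') bw) //.
by rewrite (vertex_bounded_le (leq_maxr n n') bu) // scaler0 addr0.
Qed.

Lemma vertex_coefP l q (a : C) v w :
  (exists n, vertex_bounded l q n v) -> (exists n, vertex_bounded l q n w) ->
  vertex_coef l q (a *: v + w) = a *: vertex_coef l q v + vertex_coef l q w.
Proof.
move=> [n bv] [n' bw].
have {}bv := vertex_bounded_le (leq_maxl n n') bv.
have {}bw := vertex_bounded_le (leq_maxr n n') bw.
rewrite !(@vertex_coefE l q (maxn n n')) //.
  by rewrite scaler_sumr -big_split /=; apply: eq_bigr => jk _; rewrite termP.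
by move=> jk jk_out; rewrite termP bv // bw // scaler0 addr0.
Qed.

Lemma vertex_coef0 l q : vertex_coef l q (0 : VP) = 0.
Proof. by rewrite (@vertex_coefE _ _ 0) ?big_nil // => ? _; rewrite linear0. Qed.

Lemma vertex_coef_span l q (G H : VP -> Prop) v :
  (forall u, G u -> exists n, vertex_bounded l q n u) ->
  (forall u, G u -> span H (vertex_coef l q u)) ->
  span G v -> span H (vertex_coef l q v).
Proof.
move=> bG GH; elim=> [|a u w Gu Gw IH]; first by rewrite vertex_coef0; apply: span0.
rewrite vertex_coefP; [|exact: bG|exact: vertex_bounded_span bG Gw].
by apply: spanD => //; apply/spanZ/GH.
Qed.

Lemma vertex_coef_sum l q (I : Type) (s : seq (C * I)) (F : I -> VP) :
  (forall x, exists n, vertex_bounded l q n (F x)) ->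
  vertex_coef l q (\sum_(t <- s) t.1 *: F t.2) =
  \sum_(t <- s) t.1 *: vertex_coef l q (F t.2).
Proof.
move=> bF; elim: s => [|t s IH]; first by rewrite !big_nil vertex_coef0.
rewrite !big_cons vertex_coefP ?IH //.
apply: (@vertex_bounded_span l q (fun u => exists x, u = F x)) => [u [x ->] //|].
by apply/spanP; exists s.
Qed.

End Vertex.

(** * Principal subspaces as spans of products of complete symmetric functions *)

Section Principal.
Variable C : fieldType.
Hypothesis char0 : [pchar C] =i pred0.
Local Notation VP := (VP C).
Implicit Types (v w : VP) (l mu c : weight) (q : rat) (i j k n : nat) (m : int) (r : seq nat).

Definition level c k : weight := alpha * k%:Z + c.

(** Tying the weight to the number of factors makes the span the sum of the F_k (x) e^(k alpha +
    c). *)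
Definition schur_vec c (u : VP) : Prop := exists r, u = schur C (level c (size r)) r.

Definition principal_vec v (u : VP) : Prop := exists s, u = foldr (@x_alpha C) v s.

Lemma principal_subspaceE v w :
  principal_subspace v w <-> span (principal_vec v) w.
Proof. by symmetry; apply: spanP. Qed.

Lemma pairing_alpha mu : pairing alpha mu = mu%:~R.
Proof. by rewrite /pairing /alpha intrM mulrAC divff // mul1r. Qed.

Lemma alpha_level c k : alpha + level c k = level c k.+1.
Proof. rewrite /level /alpha; lia. Qed.

Lemma layer_schur_vec mu c k d v :
  mu = level c k -> span (layer (C := C) mu k d) v -> span (schur_vec c) v.
Proof.
move=> ->; apply: span_trans => u [r [sz_r _] ->]; apply: span_gen.
by exists r; rewrite sz_r.
Qed.

Lemma vertex_bounded_schur_vec l q c v : span (schur_vec c) v ->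
  exists n, vertex_bounded l q n v.
Proof.
by apply: vertex_bounded_span => u [r ->]; apply: vertex_bounded_schur.
Qed.

(** In each term E^+ preserves the number of factors, E^-_j adds the factor S_j, and e^alpha raises
    the weight to match. *)
Lemma x_alpha_schur_vec c m v :
  span (schur_vec c) v -> span (schur_vec c) (x_alpha m v).
Proof.
move=> Gv; rewrite /x_alpha /vertex_coef; apply: span_fsum => jk _.
apply: (@span_map _ _ _ (vertex_term alpha (- m - 1)%:~R jk) _ _ _ _ Gv).
move=> _ [r ->]; rewrite [X in span _ X]vertex_term_schur.
case: eqP => _; last exact: span0.
apply: (@layer_schur_vec (alpha + level c (size r)) c (size r).+1
  ((sumn r)%:Z - Posz jk.2 + Posz jk.1)); first exact: alpha_level.
apply: (@Em_layer _ _ _ _ (Posz jk.1)).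
by apply/Eplus_layer/span_gen => //; exists r.
Qed.

Lemma principal_vec_schur_vec c v :
  span (principal_vec (exp_vec C c)) v -> span (schur_vec c) v.
Proof.
apply: span_trans => u [s ->]; elim: s => [|m s IH] /=.
  by apply: span_gen; exists [::]; rewrite /level /schur /= mulr0 add0r.
exact: x_alpha_schur_vec.
Qed.

Lemma x_alpha_principal_vec c m v :
  span (principal_vec (exp_vec C c)) v ->
  span (principal_vec (exp_vec C c)) (x_alpha m v).
Proof.
apply: vertex_coef_span => u [s ->].
  apply: (@vertex_bounded_schur_vec _ _ c); apply: principal_vec_schur_vec.
  by apply: span_gen; exists s.
by apply: span_gen; exists (m :: s).
Qed.

(* The lowest term of x_alpha(m) schur r is Em_j (schur r); the others involve
   schur vectors of lower degree. *)
Lemma schur_vec_principal_vec c v :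
  span (schur_vec c) v -> span (principal_vec (exp_vec C c)) v.
Proof.
apply: span_trans => _ [r ->].
have [k sz_r] : exists k, size r = k by exists (size r).
rewrite sz_r; elim: k r sz_r => [|k IHk] [|j r] //=.
  by move=> _; apply: span_gen; exists [::]; rewrite /level /schur /= mulr0 add0r.
(* Inner induction on the degree of [r] alone, for all new indices [j] at once. *)
move=> [sz_r]; have [d] : exists d, sumn r = d by exists (sumn r).
elim/ltn_ind: d j r sz_r => d IHd j r sz_r sum_r.
(* With this mode the power of x is <alpha, [level c k]> + j, so that the term [(j, 0)] occurs. *)
pose m : int := - 1 - level c k - j%:Z.
have m_q : (- m - 1)%:~R = (level c k)%:~R + j%:R :> rat.
  by rewrite -[j%:R]/((Posz j)%:~R) -intrD /m; congr (_%:~R); lia.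
have : span (principal_vec (exp_vec C c)) (x_alpha m (schur C (level c k) r)).
  exact/x_alpha_principal_vec/IHk.
have [n0 b0] := vertex_bounded_schur char0 alpha (- m - 1)%:~R (level c k) r.
have {b0} b := vertex_bounded_le (leq_maxl n0 j.+1) b0.
rewrite /x_alpha (vertex_coefE b) (bigD1_seq (j, 0%N)) ?box_uniq //=; last first.
  by rewrite mem_box /=; lia.
rewrite vertex_term_schur /= pairing_alpha m_q addr0 addrK eqxx Eplus0 alpha_level.
move=> Hsum; rewrite -[X in span _ X](addrK (\sum_(i <- box (maxn n0 j.+1) | i != (j, 0%N))
  vertex_term alpha (- m - 1)%:~R i (schur C (level c k) r))).
move: Hsum; rewrite m_q => Hsum; apply: spanB => //.
apply: span_sum => -[j' k'] ne; rewrite vertex_term_schur /=.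
case: eqP => [E|_]; last exact: span0.
(* [k' = 0] would force [j' = j], the excluded term; hence E^+ strictly lowers the degree and the
   inner induction applies. *)
have k'_gt0 : (0 < k')%N.
  rewrite lt0n; apply: contra ne => /eqP k'0; move: E; rewrite k'0 pairing_alpha => E.
  have /eqP : j'%:R = j%:R :> rat by lra.
  by rewrite eqr_nat => /eqP ->.
have Gk' : span (layer (C := C) (level c k.+1) k ((sumn r)%:Z - Posz k'))
    (Eplus (- alpha) k' (schur C (alpha + level c k) r)).
  by rewrite alpha_level; apply/Eplus_layer/span_gen => //; exists r.
apply: span_map Gk' => u [r' [sz_r' sum_r'] ->].
by apply: (IHd (sumn r')) => //; lia.
Qed.

Lemma principal_subspace_schur c v :
  principal_subspace (exp_vec C c) v <-> span (schur_vec c) v.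
Proof.
split=> [/principal_subspaceE|H]; first exact: principal_vec_schur_vec.
exact/principal_subspaceE/schur_vec_principal_vec.
Qed.

End Principal.

(** * Linear independence *)

Section Independence.
Variable C : fieldType.
Hypothesis char0 : [pchar C] =i pred0.
Local Notation VP := (VP C).
Implicit Types (v w : VP) (b : monomial * weight) (mu c : weight) (i j k n : nat) (r : seq nat).

Lemma vcoefP b (a : C) v w : vcoef b (a *: v + w) = a * vcoef b v + vcoef b w.
Proof. by rewrite /vcoef coeffD coeffZ. Qed.

Lemma vcoef0 b : vcoef b (0 : VP) = 0.
Proof. exact: coeff0. Qed.

Lemma vcoef_sum b (I : Type) (s : seq I) (a : I -> C) (F : I -> VP) :
  vcoef b (\sum_(i <- s) a i *: F i) = \sum_(i <- s) a i * vcoef b (F i).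
Proof.
elim: s => [|i s IH]; first by rewrite !big_nil vcoef0.
by rewrite !big_cons vcoefP IH.
Qed.

Lemma vcoef_bvec b b' : vcoef b (bvec C b') = (b' == b)%:R.
Proof. by rewrite /vcoef [LHS]coeffU mul1r. Qed.

Definition nparts r := count (fun i => i != 0%N) r.

(** The product of the h(-i) over the nonzero entries: since S_i is h(-i)/i plus products of several
    modes, this is the monomial of S_r1 ... S_rk with fewest factors. *)
Definition lead_monomial r : monomial :=
  foldr (fun i f => if i is j.+1 then mulcm f (ucm j) else f) (onecm nat) r.

Lemma lead_monomialE r j : lead_monomial r j = count_mem j.+1 r.
Proof.
elim: r => [|[|i] r IH] /=; first exact: onecmE.
  by rewrite IH.
by rewrite mulcmE ucmE IH addnC eqSS.
Qed.

Lemma mdeg_lead_monomial r : mdeg (lead_monomial r) = nparts r.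
Proof.
elim: r => [|[|i] r IH] /=; first exact: mdeg1.
  by rewrite IH.
by rewrite mdegM mdegU IH addnC.
Qed.

(** The monomial counts the positive entries; the length then determines the number of zeros. *)
Lemma perm_eq_lead_monomial r r' :
  size r = size r' -> lead_monomial r = lead_monomial r' -> perm_eq r r'.
Proof.
move=> eq_sz eq_lead; have eqS j : count_mem j.+1 r = count_mem j.+1 r'.
  by rewrite -!lead_monomialE eq_lead.
apply/allP => -[|j] _ /=; last exact/eqP/eqS.
have := count_predC (pred1 0%N) r; rewrite eq_sz -(count_predC (pred1 0%N) r').
have : nparts r = nparts r' by rewrite -!mdeg_lead_monomial eq_lead.
by rewrite /nparts => -> /addIn ->.
Qed.

(** Filtration by the number of factors, every h(-i) counting once, unlike the degree used in
    [layer]. *)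
Definition many_factors mu n (u : VP) : Prop :=
  exists2 b, (n <= mdeg b.1)%N & b.2 = mu /\ u = bvec C b.

Lemma vcoef_many_factors mu n b v : (mdeg b.1 < n)%N ->
  span (many_factors mu n) v -> vcoef b v = 0.
Proof.
move=> lt_n; elim=> [|a u w [b' le_n [_ ->]] _ IH]; first exact: vcoef0.
rewrite vcoefP IH vcoef_bvec addr0; case: eqP => [bb'|]; last by rewrite mulr0.
by move: lt_n; rewrite -bb' ltnNge le_n.
Qed.

Lemma heis_many_factors mu n i v :
  span (many_factors mu n) v -> span (many_factors mu n.+1) (heis (Negz i) v).
Proof.
apply: span_map => _ [b le_n [<- ->]]; rewrite [X in span _ X]heis_neg_bvec.
apply: span_gen; exists (mulcm b.1 (ucm i), b.2) => //=.
by rewrite mdegM mdegU addn1.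
Qed.

Lemma Eminus_schur_rec j v :
  Eminus (- alpha) j.+1 v =
  (j.+1%:R^-1 : C) *: \sum_(i < j.+1) heis (Negz i) (Eminus (- alpha) (j - i) v).
Proof.
apply: (scalerI (natC_neq0 char0 j)).
rewrite scalerA divff ?natC_neq0 // scale1r Eminus_rec //.
have two_neq0 : 2%:R != 0 :> C := natC_neq0 char0 1.
by rewrite /alpha -mulNr -rmorphN opprK divff ?scale1r.
Qed.

Lemma Eminus_many_factors mu n j v :
  span (many_factors mu n) v -> span (many_factors mu (n + (0 < j))) (Eminus (- alpha) j v).
Proof.
have weaken n1 n2 u : (n1 <= n2)%N -> span (many_factors mu n2) u -> span (many_factors mu n1) u.
  move=> le12; apply: span_trans => _ [b le_n [<- ->]]; apply: span_gen.
  by exists b => //; apply: leq_trans le_n.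
elim/ltn_ind: j n v => -[|j] IH n v Gv; first by rewrite Eminus0 addn0.
rewrite addn1 Eminus_schur_rec; apply/spanZ/span_sum => i _.
apply: heis_many_factors; apply: (weaken _ (n + (0 < j - i))%N); first exact: leq_addr.
by apply: IH => //; rewrite ltnS leq_subr.
Qed.

(** In the recursion for S_(j + 1) only the last summand is a single mode; each other one multiplies
    h(-i - 1) by S_(j - i) with j - i > 0. *)
Lemma Eminus_lead mu n j v : span (many_factors mu n) v ->
  span (many_factors mu n.+2)
    (Eminus (- alpha) j.+1 v - (j.+1%:R^-1 : C) *: heis (Negz j) v).
Proof.
move=> Gv; rewrite Eminus_schur_rec -scalerBr big_ord_recr /= subnn Eminus0 addrK.
apply/spanZ/span_sum => i _; apply: heis_many_factors.
have := @Eminus_many_factors mu n (j - i) v Gv.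
by rewrite subn_gt0 ltn_ord addn1.
Qed.

Lemma schur_lead mu r : exists2 a : C, a != 0 &
  span (many_factors mu (nparts r).+1) (schur C mu r - a *: bvec C (lead_monomial r, mu)).
Proof.
elim: r => [|[|j] r [a a_neq0 IH]].
- by exists 1; rewrite ?oner_neq0 // scale1r subrr; apply: span0.
- by exists a => //; rewrite /schur /= Eminus0.
exists (a / j.+1%:R); first by rewrite mulf_neq0 ?invr_eq0 ?natC_neq0.
set b := bvec C (lead_monomial r, mu) in IH.
have -> : schur C mu (j.+1 :: r) - (a / j.+1%:R) *: bvec C (lead_monomial (j.+1 :: r), mu) =
    Eminus (- alpha) j.+1 (schur C mu r - a *: b)
    + a *: (Eminus (- alpha) j.+1 b - (j.+1%:R^-1 : C) *: heis (Negz j) b).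
  have EB (x y : VP) : Eminus (- alpha) j.+1 (x - a *: y) =
      Eminus (- alpha) j.+1 x - a *: Eminus (- alpha) j.+1 y.
    by rewrite [LHS]linearB linearZ_LR.
  by rewrite EB scalerBr scalerA addrA subrK heis_neg_bvec.
apply: spanD; first by have := Eminus_many_factors j.+1 IH; rewrite addn1.
apply/spanZ/Eminus_lead/span_gen; exists (lead_monomial r, mu) => //=.
by rewrite mdeg_lead_monomial.
Qed.

(** Products of the S_i ignore the order of the indices, so coefficients are collected over
    permutation classes, represented by sorted lists. *)
Definition class_coef (s : seq (C * seq nat)) r : C :=
  \sum_(t <- s | sort leq t.2 == r) t.1.

Lemma sum_class (V : lmodType C) (Phi : seq nat -> V) (s : seq (C * seq nat)) :
  (forall r r', perm_eq r r' -> Phi r = Phi r') ->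
  \sum_(t <- s) t.1 *: Phi t.2 =
  \sum_(r <- undup [seq sort leq t.2 | t <- s]) class_coef s r *: Phi r.
Proof.
move=> Phi_perm; set U := undup _.
have U_uniq : uniq U by apply: undup_uniq.
under [RHS]eq_bigr do rewrite /class_coef scaler_suml big_mkcond.
rewrite exchange_big /= big_seq [RHS]big_seq; apply: eq_bigr => t ts.
have tU : sort leq t.2 \in U by rewrite mem_undup; apply/mapP; exists t.
rewrite (bigD1_seq _ tU U_uniq) /= eqxx big1 => [|r /negPf]; last first.
  by rewrite eq_sym => ->.
by rewrite addr0; congr (_ *: _); apply: Phi_perm; rewrite perm_sym perm_sort.
Qed.

(* In a relation between Schur vectors, the coefficient of the monomial of
   lowest degree only sees one multiset of indices. *)
Lemma schur_independent c (s : seq (C * seq nat)) :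
  \sum_(t <- s) t.1 *: schur C (level c (size t.2)) t.2 = 0 ->
  forall r, r \in undup [seq sort leq t.2 | t <- s] -> class_coef s r = 0.
Proof.
have Phi_perm r r' : perm_eq r r' ->
    schur C (level c (size r)) r = schur C (level c (size r')) r'.
  by move=> rr'; rewrite (perm_size rr') (schur_perm C _ rr').
rewrite (sum_class s Phi_perm); set U := undup _ => rel r.
have [n] : exists n, nparts r = n by exists (nparts r).
elim/ltn_ind: n r => n IH r r_n rU.
have [a a_neq0 lead_r] := schur_lead (level c (size r)) r.
pose b := (lead_monomial r, level c (size r)).
have coef_r : vcoef b (schur C (level c (size r)) r) = a.
  have := vcoef_many_factors (b := b) _ lead_r.
  rewrite /= mdeg_lead_monomial => /(_ (ltnSn _)) H.
  rewrite -[schur _ _ _](subrK (a *: bvec C b)) -[X in vcoef b X]addrC vcoefP H.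
  by rewrite vcoef_bvec eqxx mulr1 addr0.
have := congr1 (vcoef b) rel; rewrite vcoef0 vcoef_sum.
rewrite (bigD1_seq _ rU) ?undup_uniq //= coef_r big_seq_cond big1 => [|p /andP[pU p_r]].
  by rewrite addr0 => /eqP; rewrite mulf_eq0 (negPf a_neq0) orbF => /eqP.
(* Classes with fewer positive entries vanish by induction; any other contains [b] only as its own
   lead monomial. *)
have [lt_n|le_n] := ltnP (nparts p) n; first by rewrite (IH _ lt_n p) ?mul0r.
have [a' _ lead_p] := schur_lead (level c (size p)) p.
have := vcoef_many_factors (b := b) _ lead_p.
rewrite /= mdeg_lead_monomial r_n ltnS => /(_ le_n) H.
rewrite -[schur _ _ _](subrK (a' *: bvec C (lead_monomial p, level c (size p)))).
rewrite -[X in vcoef b X]addrC vcoefP H vcoef_bvec addr0.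
case: eqP => [[eq_lead eq_lev]|]; last by rewrite !mulr0.
have eq_sz : size p = size r by move: eq_lev => /addIr /(mulfI (isT : alpha != 0)) [].
have sU u : u \in U -> sorted leq u.
  by rewrite mem_undup => /mapP[t _ ->]; apply: sort_sorted; apply: leq_total.
case/eqP: p_r; apply: (sorted_eq leq_trans anti_leq) => //; try exact: sU.
exact: perm_eq_lead_monomial.
Qed.

(** By independence a symmetric assignment [Phi] extends to a linear map on the span, so it carries
    relations to relations. *)
Lemma schur_relation c (s : seq (C * seq nat)) (V : lmodType C) (Phi : seq nat -> V) :
  (forall r r', perm_eq r r' -> Phi r = Phi r') ->
  \sum_(t <- s) t.1 *: schur C (level c (size t.2)) t.2 = 0 ->
  \sum_(t <- s) t.1 *: Phi t.2 = 0.
Proof.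
move=> Phi_perm rel; rewrite sum_class // big_seq big1 // => r rU.
by rewrite (schur_independent rel) ?scale0r.
Qed.

End Independence.

(** * The exact sequence *)

Section HalfVertex.
Variable C : fieldType.
Hypothesis char0 : [pchar C] =i pred0.
Local Notation VP := (VP C).
Implicit Types (v w : VP) (r : seq nat).

(** The value of o(e^(alpha/2)) on the product indexed by [r], with S_(-1) = 0. *)
Definition schur_shift r : VP :=
  if 0%N \in r then 0 else schur C (level half_alpha (size r)) (map predn r).

Lemma half_alpha_level0 k : half_alpha + level 0 k = level half_alpha k.
Proof. by rewrite /level addr0 addrC. Qed.

Lemma half_alpha_level1 k : half_alpha + level half_alpha k = level 0 k.+1.
Proof. rewrite /level /alpha /half_alpha; lia. Qed.

Lemma pairing_half_level0 k : pairing half_alpha (level 0 k) = k%:R.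
Proof.
by rewrite /pairing /half_alpha /level /alpha mul1r addr0 intrM mulrAC divff // mul1r.
Qed.

(* Only E^-_0 E^+_k survives in the constant term on level k, as E^+_i kills
   the products of fewer than i modes. *)
Lemma vertex_coef_half (a : C) r :
  vertex_coef half_alpha 0 (a *: schur C (level 0 (size r)) r) =
  (a * (-1) ^+ size r) *: schur_shift r.
Proof.
have termE jk : vertex_term half_alpha 0 jk (a *: schur C (level 0 (size r)) r) =
    a *: vertex_term half_alpha 0 jk (schur C (level 0 (size r)) r).
  exact: linearZ_LR.
rewrite [LHS](_ : _ = \sum_(jk \in [set (0%N, size r)]%classic)
    vertex_term half_alpha 0 jk (a *: schur C (level 0 (size r)) r)); last first.
  apply/esym/fsbig_widen => // -[j k] [_ /= /eqP ne].
  rewrite termE vertex_term_schur /= pairing_half_level0.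
  case: eqP => [E|_]; last by rewrite scaler0.
  (* As <alpha/2, n alpha> = n, the constant term pairs E^-_j with E^+_(n + j). *)
  have Ek : k = (size r + j)%N.
    by apply/eqP; rewrite -(eqr_nat rat) natrD E sub0r addrAC addNr add0r.
  have j_gt0 : (0 < j)%N.
    by rewrite lt0n; apply: contra ne => /eqP j0; rewrite Ek j0 addn0.
  by rewrite Ep_schur_eq0 ?linear0 ?scaler0 // Ek; lia.
rewrite fsbig_set1 termE vertex_term_schur /= pairing_half_level0 subr0 add0r eqxx.
by rewrite Eminus0 Ep_schur_top // scalerA half_alpha_level0.
Qed.

End HalfVertex.

(** * The two maps on the principal subspaces *)

Section Exactness.
Variable R : realType.
Local Notation C := (R[i] : fieldType).
Local Notation VP := (VP R[i]).
Implicit Types (v w : VP) (r : seq nat).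

Lemma char0_complex : [pchar R[i]] =i pred0.
Proof. exact: pchar_num. Qed.

Lemma expi_pi n : expi (pi *+ n : R) = (-1) ^+ n.
Proof.
rewrite /expi -[pi *+ n]add0r (alternatingn (@cosDpi R)) (alternatingn (@sinDpi R)).
rewrite cos0 sin0 mulr0 mulr1.
elim: n => // n IH; rewrite !exprS -IH; apply/eqP; rewrite eq_complex /=.
by apply/andP; split; apply/eqP; ring.
Qed.

Definition exp_ipi : {linear VP -> VP} :=
  linear_pack (f := @exp_ipi_half_alpha R) (fglift_is_linear _).

Lemma exp_ipi_schur r :
  exp_ipi_half_alpha (schur R[i] (level 0 (size r)) r) =
  (-1) ^+ size r *: schur R[i] (level 0 (size r)) r.
Proof.
apply: (schur_map (T := exp_ipi)) => [i u|].
  apply: (bvec_ext (f := exp_ipi \o heis (Negz i))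
                   (g := heis (Negz i) \o exp_ipi)) => b /=.
  rewrite heis_neg_bvec [LHS]fgliftU [in RHS]/exp_ipi_half_alpha fgliftU.
  by rewrite !scale1r !bvecZ linearZ_LR /= heis_neg_bvec.
rewrite [LHS]fgliftU scale1r bvecZ; congr (_ *: _).
rewrite -expi_pi; congr expi; rewrite pairing_alpha ratr_int /level /alpha /= addr0 intrM.
by rewrite [2%:~R * _]mulrC mulrA mulfK ?pnatr_eq0 // mulr_natr.
Qed.

(** The sign (-1)^k by which e^(i pi alpha / 2) acts cancels the sign of the top coefficient of
    E^+. *)
Lemma o_half_alpha_schur r :
  o_half_alpha (schur R[i] (level 0 (size r)) r) = schur_shift R[i] r.
Proof.
rewrite /o_half_alpha /intertwiner_coef exp_ipi_schur (vertex_coef_half char0_complex).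
by rewrite -exprD addnn -mul2n exprM sqrrN !expr1n scale1r.
Qed.

Lemma o_half_alpha_sum (s : seq (R[i] * seq nat)) :
  o_half_alpha (\sum_(t <- s) t.1 *: schur R[i] (level 0 (size t.2)) t.2) =
  \sum_(t <- s) t.1 *: schur_shift R[i] t.2.
Proof.
have T_sum : exp_ipi_half_alpha (\sum_(t <- s) t.1 *: schur R[i] (level 0 (size t.2)) t.2) =
    \sum_(t <- s) t.1 *: exp_ipi_half_alpha (schur R[i] (level 0 (size t.2)) t.2).
  by rewrite [LHS](linear_sum exp_ipi); apply: eq_bigr => t _; apply: (linearZ_LR exp_ipi).
rewrite /o_half_alpha /intertwiner_coef T_sum.
rewrite (vertex_coef_sum s (F := fun r => exp_ipi_half_alpha (schur R[i] (level 0 (size r)) r))).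
  by apply: eq_bigr => t _; rewrite [vertex_coef _ _ _]o_half_alpha_schur.
move=> r; rewrite exp_ipi_schur.
have [n b] := vertex_bounded_schur char0_complex half_alpha 0 (level 0 (size r)) r.
by exists n => jk jk_out; rewrite linearZ_LR /= b // scaler0.
Qed.

Lemma mem_W_Lambda0 v : W_Lambda0 v <->
  exists s : seq (R[i] * seq nat),
    v = \sum_(t <- s) t.1 *: schur R[i] (level 0 (size t.2)) t.2.
Proof.
apply: iff_trans (principal_subspace_schur char0_complex 0 v) _.
exact: (spanP (fun r => schur R[i] (level 0 (size r)) r)).
Qed.

Lemma mem_W_Lambda1 v : W_Lambda1 v <->
  exists s : seq (R[i] * seq nat),
    v = \sum_(t <- s) t.1 *: schur R[i] (level half_alpha (size t.2)) t.2.
Proof.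
apply: iff_trans (principal_subspace_schur char0_complex half_alpha v) _.
exact: (spanP (fun r => schur R[i] (level half_alpha (size r)) r)).
Qed.

(** The raised weight asks for one more factor, supplied by S_0 = 1. *)
Lemma exp_op_sum (s : seq (R[i] * seq nat)) :
  exp_op half_alpha (\sum_(t <- s) t.1 *: schur R[i] (level half_alpha (size t.2)) t.2) =
  \sum_(t <- s) t.1 *: schur R[i] (level 0 (size (0%N :: t.2))) (0%N :: t.2).
Proof.
rewrite linear_sum; apply: eq_bigr => t _.
rewrite linearZ_LR /= exp_op_schur half_alpha_level1; congr (_ *: _).
by rewrite [RHS]Eminus0.
Qed.

Lemma exp_op_W v : W_Lambda1 v -> W_Lambda0 (exp_op half_alpha v).
Proof.
move=> /mem_W_Lambda1[s ->]; apply/mem_W_Lambda0.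
by exists [seq (t.1, 0%N :: t.2) | t <- s]; rewrite exp_op_sum big_map.
Qed.

Lemma o_half_alpha_exp_op v : W_Lambda1 v -> o_half_alpha (exp_op half_alpha v) = 0.
Proof.
move=> /mem_W_Lambda1[s ->]; rewrite exp_op_sum.
rewrite -(big_map (fun t => (t.1, 0%N :: t.2)) xpredT
  (fun t => t.1 *: schur R[i] (level 0 (size t.2)) t.2)).
rewrite o_half_alpha_sum big_map big1 // => t _.
by rewrite /schur_shift inE eqxx scaler0.
Qed.

Lemma o_half_alpha_W v : W_Lambda0 v -> W_Lambda1 (o_half_alpha v).
Proof.
move=> /mem_W_Lambda0[s ->]; apply/mem_W_Lambda1; rewrite o_half_alpha_sum.
exists [seq (t.1, map predn t.2) | t <- s & 0%N \notin t.2].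
rewrite big_map big_filter [RHS]big_mkcond; apply: eq_bigr => t _ /=.
by rewrite /schur_shift size_map; case: (0%N \in t.2); rewrite ?scaler0.
Qed.

(** Raising every index by one gives a preimage, since no index is then 0. *)
Lemma o_half_alpha_surj v : W_Lambda1 v -> exists2 u, W_Lambda0 u & o_half_alpha u = v.
Proof.
move=> /mem_W_Lambda1[s ->].
have predSK r : map predn (map succn r) = r by rewrite -map_comp map_id.
exists (\sum_(t <- [seq (t.1, map succn t.2) | t <- s])
  t.1 *: schur R[i] (level 0 (size t.2)) t.2).
  by apply/mem_W_Lambda0; eexists.
rewrite o_half_alpha_sum big_map; apply: eq_bigr => t _.
rewrite /schur_shift /= size_map predSK ifN //.
by apply/mapP => -[].
Qed.

(* The relation [o v = 0] among the shifted Schur vectors lifts to a relation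
   among those of the terms of v without index 0; what remains of v has an index
   0, hence comes from one Schur factor less. *)
Lemma o_half_alpha_ker v : W_Lambda0 v -> o_half_alpha v = 0 ->
  exists2 u, W_Lambda1 u & exp_op half_alpha u = v.
Proof.
move=> /mem_W_Lambda0[s ->]; rewrite o_half_alpha_sum => rel.
pose s1 := [seq (t.1, map predn t.2) | t <- s & 0%N \notin t.2].
have rel1 : \sum_(t <- s1) t.1 *: schur R[i] (level half_alpha (size t.2)) t.2 = 0.
  rewrite -[RHS]rel big_map big_filter big_mkcond; apply: eq_bigr => t _ /=.
  by rewrite /schur_shift size_map; case: (0%N \in t.2); rewrite ?scaler0.
(* [Phi] undoes the shift on lists without 0 and returns to the weights of V_Q. *)
pose Phi r := schur R[i] (level 0 (size r)) (map succn r).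
have Phi_perm r r' : perm_eq r r' -> Phi r = Phi r'.
  by move=> rr'; rewrite /Phi (perm_size rr') (schur_perm _ _ (perm_map succn rr')).
have := schur_relation char0_complex Phi_perm rel1.
rewrite big_map big_filter => rel0.
(* One index 0 is dropped from each term that has one; e^(alpha/2) restores it. *)
exists (\sum_(t <- [seq (t.1, rem 0%N t.2) | t <- s & 0%N \in t.2])
  t.1 *: schur R[i] (level half_alpha (size t.2)) t.2).
  by apply/mem_W_Lambda1; eexists.
rewrite exp_op_sum big_map big_filter [RHS](bigID (fun t => 0%N \in t.2)) /=.
rewrite [X in _ = _ + X](_ : _ = 0) ?addr0.
  apply: eq_bigr => t t0; have pt := perm_to_rem t0.
  by rewrite (perm_size pt) (schur_perm _ _ pt).
rewrite -[RHS]rel0; apply: eq_bigr => t t0; rewrite /Phi /= size_map.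
congr (_ *: schur _ _ _); rewrite -map_comp -[LHS]map_id; apply/eq_in_map => -[|i] //= it.
by rewrite it in t0.
Qed.

End Exactness.

Theorem theorem4p1 (R : realType) :
  short_exact (W_Lambda1 (C := R[i])) (W_Lambda0 (C := R[i])) (W_Lambda1 (C := R[i]))
    (exp_op half_alpha) (o_half_alpha (R := R)).
Proof.
split.
- by move=> _ [v Wv <-]; apply: exp_op_W.
- by move=> _ [v Wv <-]; apply: o_half_alpha_W.
- by move=> u v _ _ /(can_inj (exp_opK half_alpha)).
- apply/seteqP; split=> [v [Wv ov0]|_ [u Wu <-]].
    by have [u Wu <-] := o_half_alpha_ker Wv ov0; exists u.
  by split; [apply: exp_op_W|apply: o_half_alpha_exp_op].
- apply/seteqP; split=> [_ [v Wv <-]|v Wv]; first exact: o_half_alpha_W.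
  by have [u Wu <-] := o_half_alpha_surj Wv; exists u.
Qed.
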